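(* For $K>2$ let $L^*(K)$ be the bifurcation line, defined implicitly as the solution $L=L^*(K)<0$ with $K+L>2$ of $$\sqrt{1-\frac{2K}{K^2-L^2}}=V\left((K+L)\sqrt{1-\frac{2K}{K^2-L^2}}\right).$$ The derivative of $L^*(K)$ has the following properties: 1. $\lim_{K\to\infty}\frac{\partial L^*(K)}{\partial K}=-1$. 2. $\lim_{K\downarrow2}\frac{\partial L^*(K)}{\partial K}=-\frac12$.
   Context: $V:\mathbb{R}\to\mathbb{R}$ is defined by $$V(x)=\frac{\int_0^{2\pi}\cos\theta\,e^{x\cos\theta}\,d\theta}{\int_0^{2\pi}e^{x\cos\theta}\,d\theta}.$$ The bifurcation line is the set of parameters $(K,L)$, $L<0$, at which solutions with $r_1\ne r_2$ of the equations $r_1=V(Kr_1+Lr_2)$, $r_2=V(Kr_2+Lr_1)$ branch off from the symmetric solution $r_1=r_2=r^*>0$. On this line $r^*=\sqrt{1-\frac{2K}{K^2-L^2}}$, and a symmetric solution with $r^*>0$ exists only if $K+L>2$. *)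

(* Defs.v *)
From Stdlib Require Import Reals.
From Coquelicot Require Import Coquelicot.
Open Scope R_scope.

Definition V (x : R) : R :=
  RInt (fun theta => cos theta * exp (x * cos theta)) 0 (2 * PI) /
  RInt (fun theta => exp (x * cos theta)) 0 (2 * PI).

(* When L < 0 and K + L > 2, one has K ^ 2 - L ^ 2 > 2 * (K - L) > 2 * K > 0,
   so that the radicand is positive: the totality of [/] and [sqrt] plays no
   role in [bifurcation_point], and r = 0 is not a spurious solution. *)
Definition r_star (K L : R) : R := sqrt (1 - 2 * K / (K ^ 2 - L ^ 2)).

Definition bifurcation_point (K L : R) : Prop :=
  L < 0 /\ K + L > 2 /\ r_star K L = V ((K + L) * r_star K L).

(* Main.v *)
(** Write [s = K + L] and [d = K - L]. If [r = V (s r)] and [x = s r], then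
    [s = x / V x]; moreover [r ^ 2 = 1 - 1 / s - 1 / d] and the Riccati equation
    [V' = 1 - V / x - V ^ 2] (valid since [V = I_1 / I_0] for Bessel functions)
    turn the bifurcation condition into [d = 1 / V' x]. So the bifurcation line
    is the curve [x > 0 |-> (s, d) = (x / V x, 1 / V' x)]. The Riccati equation
    and integrating factors give [V > 0], [V' > 0], [V'' < 0] for [x > 0], so
    [s' > 0] and [d' > 0]; hence [K = (s + d) / 2] is an increasing bijection
    onto the numbers greater than [2], and
    [dL / dK = (s' - d') / (s' + d')].
    At [0], [s' ~ x / 2] and [d' ~ 3 x / 2]; at infinity [s'] is bounded while
    [d'] grows at least linearly. *)

Require Import Defs.
From Stdlib Require Import Reals Ranalysis5 Lra.
From Coquelicot Require Import Coquelicot.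
Open Scope R_scope.

(** * Moments and the Riccati equation *)

(** [2 * PI] times the [n]-th derivative of the Bessel function [I_0]. *)
Definition moment (n : nat) (x : R) : R :=
  RInt (fun theta => cos theta ^ n * exp (x * cos theta)) 0 (2 * PI).

Lemma continuous_moment_integrand (n : nat) (x t : R) :
  continuous (fun theta => cos theta ^ n * exp (x * cos theta)) t.
Proof.
apply (ex_derive_continuous (fun theta => cos theta ^ n * exp (x * cos theta))).
auto_derive; trivial.
Qed.

Lemma ex_RInt_moment (n : nat) (x : R) :
  ex_RInt (fun theta => cos theta ^ n * exp (x * cos theta)) 0 (2 * PI).
Proof.
apply (@ex_RInt_continuous R_CompleteNormedModule).
intros t _; apply continuous_moment_integrand.
Qed.

(** Differentiation under the integral sign: each [x]-derivative brings down one factor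
    [cos theta]. *)
Lemma is_derive_moment (n : nat) (x : R) :
  is_derive (moment n) x (moment (S n) x).
Proof.
assert (D : forall u t : R,
  is_derive (fun z => cos t ^ n * exp (z * cos t)) u
    (cos t ^ S n * exp (u * cos t))).
{ intros u t; auto_derive; trivial; simpl; ring. }
unfold moment.
replace (RInt (fun theta => cos theta ^ S n * exp (x * cos theta)) 0 (2 * PI))
  with (RInt (fun t => Derive (fun u => cos t ^ n * exp (u * cos t)) x)
          0 (2 * PI)).
2: { apply RInt_ext; intros t _; apply is_derive_unique, D. }
apply (is_derive_RInt_param
  (fun z theta => cos theta ^ n * exp (z * cos theta))).
- apply filter_forall; intros y t _; eexists; apply D.
- intros t _.
  apply continuity_2d_pt_ext with (fun u v => cos v ^ S n * exp (u * cos v)).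
  { intros u v; symmetry; apply is_derive_unique, D. }
  apply continuity_2d_pt_mult.
  + apply (continuity_1d_2d_pt_comp (fun z => cos z ^ S n) (fun _ v => v)).
    * apply derivable_continuous_pt; reg.
    * apply continuity_2d_pt_id2.
  + apply (continuity_1d_2d_pt_comp exp (fun u v => u * cos v)).
    * apply derivable_continuous_pt; reg.
    * apply continuity_2d_pt_mult; [apply continuity_2d_pt_id1|].
      apply (continuity_1d_2d_pt_comp cos (fun _ v => v)).
      -- apply derivable_continuous_pt; reg.
      -- apply continuity_2d_pt_id2.
- apply filter_forall; intros y; apply ex_RInt_moment.
Qed.

Lemma moment0_gt0 (x : R) : 0 < moment 0 x.
Proof.
apply RInt_gt_0.
- pose proof PI_RGT_0; lra.
- intros t _; simpl; rewrite Rmult_1_l; apply exp_pos.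
- intros t _; apply continuous_moment_integrand.
Qed.

Lemma moment1_0 : moment 1 0 = 0.
Proof.
unfold moment; apply is_RInt_unique.
apply is_RInt_ext with cos.
{ intros t _; rewrite Rmult_0_l, exp_0; simpl; ring. }
replace 0 with (minus (sin (2 * PI)) (sin 0)) at 2.
2: { rewrite sin_2PI, sin_0; unfold minus, plus, opp; simpl; ring. }
apply (is_RInt_derive sin cos).
- intros t _; auto_derive; trivial; ring.
- intros t _; apply (ex_derive_continuous cos); auto_derive; trivial.
Qed.

(** Bessel's equation for [I_0], multiplied by [x] so as to hold at [0] too. The difference of the
    two sides is the integral of the derivative of [- sin t * exp (x * cos t)], which vanishes at
    both ends. *)
Lemma moment2_mul (x : R) : x * moment 2 x = x * moment 0 x - moment 1 x.
Proof.
enough (H : is_RInt (fun t => x * (1 * exp (x * cos t))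
    - x * (cos t ^ 2 * exp (x * cos t)) - cos t ^ 1 * exp (x * cos t))
    0 (2 * PI) 0).
{ assert (H' : is_RInt (fun t => x * (1 * exp (x * cos t))
    - x * (cos t ^ 2 * exp (x * cos t)) - cos t ^ 1 * exp (x * cos t))
    0 (2 * PI) (x * moment 0 x - x * moment 2 x - moment 1 x)).
  { apply (is_RInt_minus (V := R_NormedModule)).
    2: apply (@RInt_correct R_CompleteNormedModule), (ex_RInt_moment 1).
    apply (is_RInt_minus (V := R_NormedModule));
      apply (is_RInt_scal (V := R_NormedModule));
      apply (@RInt_correct R_CompleteNormedModule).
    - apply (ex_RInt_moment 0).
    - apply (ex_RInt_moment 2). }
  apply (is_RInt_unique (V := R_CompleteNormedModule)) in H, H'; lra. }
replace 0 with
  (minus (- sin (2 * PI) * exp (x * cos (2 * PI))) (- sin 0 * exp (x * cos 0)))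
  at 2.
2: { rewrite sin_2PI, sin_0; unfold minus, plus, opp; simpl; ring. }
apply (is_RInt_derive (fun t => - sin t * exp (x * cos t))).
- intros t _; auto_derive; trivial.
  generalize (sin2_cos2 t); unfold Rsqr; intros E.
  replace (cos t ^ 2) with (1 - sin t * sin t) by (simpl; lra).
  ring.
- intros t _.
  apply (ex_derive_continuous (fun t => x * (1 * exp (x * cos t))
    - x * (cos t ^ 2 * exp (x * cos t)) - cos t ^ 1 * exp (x * cos t))).
  auto_derive; trivial.
Qed.

Lemma V_moment (x : R) : V x = moment 1 x / moment 0 x.
Proof.
unfold V, moment.
apply (f_equal2 Rdiv); apply RInt_ext; intros t _; simpl; ring.
Qed.

(** * Mean value tools; signs and bounds for [V] and its derivative *)

Lemma is_derive_mvt (f df : R -> R) (a b : R) : a < b ->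
  (forall c, a <= c <= b -> is_derive f c (df c)) ->
  exists c, a < c < b /\ f b - f a = df c * (b - a).
Proof.
intros ab D.
destruct (MVT_cor2 f df a b ab) as [c [E Hc]].
{ intros c Hc; apply is_derive_Reals, D, Hc. }
now exists c.
Qed.

(** The mean value theorem from [0]; [df] may vanish at [0] itself, as [x * moment 0 x] does. *)
Lemma gt0_of_derive (f df : R -> R) (x : R) : 0 < x -> f 0 = 0 ->
  (forall c, 0 <= c -> is_derive f c (df c)) ->
  (forall c, 0 < c -> 0 < df c) -> 0 < f x.
Proof.
intros x0 f0 D P.
destruct (is_derive_mvt f df 0 x x0) as [c [Hc E]].
{ intros c Hc; apply D; lra. }
rewrite f0, !Rminus_0_r in E; rewrite E.
apply Rmult_lt_0_compat; [apply P|]; lra.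
Qed.

Ltac moment_derive :=
  auto_derive; [repeat split; eexists; apply is_derive_moment |
   rewrite ?(is_derive_unique (fun x => moment 0 x) _ _ (is_derive_moment 0 _)),
           ?(is_derive_unique (fun x => moment 1 x) _ _ (is_derive_moment 1 _))].

(** By Bessel's equation, [x * moment 1 x] has derivative [x * moment 0 x]. *)
Lemma moment1_gt0 (x : R) : 0 < x -> 0 < moment 1 x.
Proof.
intros x0.
enough (0 < x * moment 1 x) by nra.
apply (gt0_of_derive (fun x => x * moment 1 x) (fun x => x * moment 0 x)).
- exact x0.
- ring.
- intros c _; moment_derive. pose proof (moment2_mul c); lra.
- intros c c0; pose proof (moment0_gt0 c); nra.
Qed.

Lemma V_gt0 (x : R) : 0 < x -> 0 < V x.
Proof.
intros x0; rewrite V_moment.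
apply Rdiv_lt_0_compat; [apply moment1_gt0, x0 | apply moment0_gt0].
Qed.

Lemma V_lt_half (x : R) : 0 < x -> V x < x / 2.
Proof.
intros x0; rewrite V_moment.
(* After Bessel's equation the derivative collapses to [x ^ 2 * moment 1 x]. *)
assert (H : 0 < x ^ 2 * moment 0 x - 2 * x * moment 1 x).
{ apply (gt0_of_derive (fun x => x ^ 2 * moment 0 x - 2 * x * moment 1 x)
    (fun x => x ^ 2 * moment 1 x)).
  - exact x0.
  - ring.
  - intros c _; moment_derive. pose proof (moment2_mul c); simpl in *; nra.
  - intros c c0; pose proof (moment1_gt0 c c0).
    apply Rmult_lt_0_compat; [apply pow_lt|]; assumption. }
pose proof (moment0_gt0 x) as A0.
apply Rmult_lt_reg_r with (moment 0 x); [exact A0|].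
unfold Rdiv at 1; rewrite Rmult_assoc, Rinv_l, Rmult_1_r by lra.
nra.
Qed.

(* The derivative of [V] away from [0]; at [0] the junk value is [1], not
   [V' 0 = 1 / 2]. *)
Definition dV (x : R) : R := 1 - V x / x - V x ^ 2.

(** The Riccati equation cleared of the denominator [x], which makes it usable on intervals that
    contain [0]. *)
Lemma is_derive_V_any (x : R) :
  exists l, is_derive V x l /\ x * l = x - V x - x * V x ^ 2.
Proof.
pose proof (moment0_gt0 x) as A0.
exists (moment 2 x / moment 0 x - (moment 1 x / moment 0 x) ^ 2); split.
- apply is_derive_ext with (fun x => moment 1 x / moment 0 x).
  { intros t; symmetry; apply V_moment. }
  auto_derive.
  + repeat split; [eexists; apply is_derive_moment ..|lra].
  + rewrite (is_derive_unique (fun x => moment 0 x) _ _ (is_derive_moment 0 _)),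
           (is_derive_unique (fun x => moment 1 x) _ _ (is_derive_moment 1 _)).
    field; lra.
- rewrite V_moment.
  transitivity (x * moment 2 x / moment 0 x - x * (moment 1 x / moment 0 x) ^ 2).
  + field; lra.
  + rewrite moment2_mul; field; lra.
Qed.

Lemma is_derive_V (x : R) : 0 < x -> is_derive V x (dV x).
Proof.
intros x0; destruct (is_derive_V_any x) as [l [D E]].
replace (dV x) with l; [exact D|].
apply Rmult_eq_reg_l with x; [|lra].
rewrite E; unfold dV; field; lra.
Qed.

Lemma dV_gt0 (x : R) : 0 < x -> 0 < dV x.
Proof.
intros x0.
(* The left side is [x * moment 0 x ^ 2 * dV x]; its derivative equals [moment 0 x * moment 1 x / x]
   for [x > 0]. *)
assert (H : 0 < x * moment 0 x ^ 2 - moment 0 x * moment 1 x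
                - x * moment 1 x ^ 2).
{ apply (gt0_of_derive (fun x => x * moment 0 x ^ 2 - moment 0 x * moment 1 x
                - x * moment 1 x ^ 2)
    (fun x => moment 0 x ^ 2 - moment 0 x * moment 2 x)).
  - exact x0.
  - rewrite moment1_0; ring.
  - intros c _; moment_derive.
    transitivity (moment 0 c ^ 2 + 2 * c * moment 0 c * moment 1 c
      - moment 1 c ^ 2 - moment 0 c * moment 2 c - moment 1 c ^ 2
      - 2 * moment 1 c * (c * moment 2 c)); [ring|].
    rewrite moment2_mul; ring.
  - intros c c0; pose proof (moment1_gt0 c c0); pose proof (moment0_gt0 c).
    replace (moment 0 c ^ 2 - moment 0 c * moment 2 c)
      with (moment 0 c * (c * moment 0 c - c * moment 2 c) / c)
      by (field; lra).
    rewrite moment2_mul.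
    apply Rdiv_lt_0_compat; [|exact c0].
    apply Rmult_lt_0_compat; lra. }
pose proof (moment0_gt0 x) as A0.
replace (dV x) with ((x * moment 0 x ^ 2 - moment 0 x * moment 1 x
                - x * moment 1 x ^ 2) / (x * moment 0 x ^ 2)).
- apply Rdiv_lt_0_compat; [exact H|].
  apply Rmult_lt_0_compat; [exact x0 | apply pow_lt, A0].
- unfold dV; rewrite V_moment; field; lra.
Qed.

(** * Concavity of V *)

(* [gap x = - x * (V x / x)'] *)
Definition gap (x : R) : R := V x / x - dV x.

(* [curv x = - V''(x)] *)
Definition curv (x : R) : R := 2 * V x * dV x - gap x / x.

Ltac V_derive H :=
  auto_derive; [repeat split; try (eexists; apply H); lra |
   rewrite ?(is_derive_unique (fun x : R => V x) _ _ H)].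

Lemma is_derive_dV (x : R) : 0 < x -> is_derive dV x (- curv x).
Proof.
intros x0; pose proof (is_derive_V x x0) as D; unfold dV at 1.
V_derive D; unfold curv, gap, dV; field; lra.
Qed.

(** A linear first-order equation for [curv] whose forcing term is positive once [gap] is. It yields
    both the sign of [curv] and its lower bound at infinity. *)
Lemma is_derive_curv (x : R) : 0 < x ->
  is_derive curv x
    (2 * (gap x / x ^ 2 + dV x ^ 2) - (1 / x + 2 * V x) * curv x).
Proof.
intros x0; pose proof (is_derive_V x x0) as D.
pose proof (is_derive_dV x x0) as D'; unfold curv at 1, gap at 1.
auto_derive.
- repeat split; try lra; eexists; [apply D|apply D'|apply D|apply D'].
- rewrite (is_derive_unique (fun x : R => V x) _ _ D),
    (is_derive_unique (fun x : R => dV x) _ _ D').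
  unfold curv, gap, dV; field; lra.
Qed.

(* Cauchy's mean value theorem for [x ^ 2 * gap x] against [x ^ 4]. *)
Lemma gap_mvt (x : R) : 0 < x ->
  exists c, 0 < c < x /\ gap x / x ^ 2 = V c / c * dV c / 2.
Proof.
intros x0.
(* [f t] is [t ^ 2 * gap t] without denominators, so that [f 0 = 0]; the auxiliary function below
   vanishes at both [0] and [x]. *)
set (f t := 2 * t * V t - t ^ 2 + t ^ 2 * V t ^ 2).
destruct (is_derive_mvt (fun t => f t * x ^ 4 - t ^ 4 * f x)
  (fun t => 2 * t * V t * (t - V t - t * V t ^ 2) * x ^ 4 - 4 * t ^ 3 * f x)
  0 x x0) as [c [Hc E]].
{ intros t _; destruct (is_derive_V_any t) as [l [D E]]; unfold f at 1.
  V_derive D.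
  rewrite <- E.
  transitivity ((2 * V t + 2 * (t * l) - 2 * t + 2 * t * V t ^ 2
    + 2 * t * V t * (t * l)) * x ^ 4 - 4 * t ^ 3 * f x); [ring|].
  rewrite E; ring. }
exists c; split; [exact Hc|].
assert (fx : f x = gap x * x ^ 2).
{ unfold f, gap, dV; field; lra. }
assert (f0 : f 0 = 0) by (unfold f; ring).
rewrite f0, fx in E.
assert (E' : 2 * c * V c * (c - V c - c * V c ^ 2) * x ^ 4
  - 4 * c ^ 3 * (gap x * x ^ 2) = 0).
{ apply Rmult_eq_reg_r with (x - 0); [|lra]; rewrite <- E; ring. }
replace (gap x / x ^ 2) with (4 * c ^ 3 * (gap x * x ^ 2) / (4 * c ^ 3 * x ^ 4))
  by (field; lra).
replace (4 * c ^ 3 * (gap x * x ^ 2))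
  with (2 * c * V c * (c - V c - c * V c ^ 2) * x ^ 4) by lra.
unfold dV; field; lra.
Qed.

Lemma Vdiv_bounds (x : R) : 0 < x -> 0 < V x / x < / 2.
Proof.
intros x0; pose proof (V_gt0 x x0); pose proof (V_lt_half x x0); split.
- now apply Rdiv_lt_0_compat.
- apply Rmult_lt_reg_r with x; [exact x0|].
  unfold Rdiv; rewrite Rmult_assoc, Rinv_l by lra; lra.
Qed.

Lemma gap_gt0 (x : R) : 0 < x -> 0 < gap x.
Proof.
intros x0; destruct (gap_mvt x x0) as [c [Hc E]].
assert (0 < gap x / x ^ 2).
{ rewrite E. pose proof (Vdiv_bounds c (proj1 Hc)).
  pose proof (dV_gt0 c (proj1 Hc)). nra. }
replace (gap x) with (gap x / x ^ 2 * x ^ 2) by (field; lra).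
apply Rmult_lt_0_compat; [assumption | apply pow_lt, x0].
Qed.

Lemma dV_lt_half (x : R) : 0 < x -> dV x < / 2.
Proof.
intros x0; pose proof (gap_gt0 x x0); pose proof (Vdiv_bounds x x0).
unfold gap in *; lra.
Qed.

(** Both [V c / c] and [dV c] are below [/ 2]. The constant is the limit at [0]. *)
Lemma gap_le (x : R) : 0 < x -> gap x / x ^ 2 <= / 8.
Proof.
intros x0; destruct (gap_mvt x x0) as [c [[c0 _] E]]; rewrite E.
pose proof (Vdiv_bounds c c0); pose proof (dV_gt0 c c0).
pose proof (dV_lt_half c c0); nra.
Qed.

Lemma increasing_of_derive (f df : R -> R) (a b : R) : 0 < a < b ->
  (forall c, 0 < c -> is_derive f c (df c)) ->
  (forall c, 0 < c -> 0 < df c) -> f a < f b.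
Proof.
intros [a0 ab] D P; destruct (is_derive_mvt f df a b ab) as [c [Hc E]].
{ intros c Hc; apply D; lra. }
enough (0 < df c * (b - a)) by lra.
apply Rmult_lt_0_compat; [apply P|]; lra.
Qed.

Lemma moment0_le (a b : R) : 0 < a < b -> moment 0 a < moment 0 b.
Proof.
intros H; apply (increasing_of_derive _ (moment 1) a b H).
- intros c _; apply is_derive_moment.
- intros c c0; apply moment1_gt0, c0.
Qed.

(* [x I_0(x)^2] is an integrating factor of the linear equation satisfied by
   [curv], and [x I_0(x)^2 curv x] tends to [0] at [0]. *)
Lemma curv_gt0 (x : R) : 0 < x -> 0 < curv x.
Proof.
intros x0.
set (G t := t * moment 0 t ^ 2 * curv t).
assert (incr : forall a b, 0 < a < b -> G a < G b).
{ intros a b H.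
  apply (increasing_of_derive G
    (fun t => 2 * t * moment 0 t ^ 2 * (gap t / t ^ 2 + dV t ^ 2)) a b H).
  - intros t t0; pose proof (is_derive_curv t t0) as D.
    pose proof (is_derive_moment 0 t) as D'.
    unfold G; auto_derive.
    + split; [eexists; apply D'|split; [eexists; apply D|trivial]].
    + rewrite (is_derive_unique (fun x : R => curv x) _ _ D),
        (is_derive_unique (fun x : R => moment 0 x) _ _ D').
      pose proof (moment0_gt0 t).
      replace (moment 1 t) with (V t * moment 0 t)
        by (rewrite V_moment; field; lra).
      field; lra.
  - intros t t0; pose proof (moment0_gt0 t); pose proof (gap_gt0 t t0).
    pose proof (dV_gt0 t t0).
    apply Rmult_lt_0_compat.
    + apply Rmult_lt_0_compat; [lra | apply pow_lt; assumption].
    + apply Rplus_lt_0_compat; [apply Rdiv_lt_0_compat|]; try assumption;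
        apply pow_lt; assumption. }
(* In [G t] the term with [V t * dV t] is positive, and [gap t <= t ^ 2 / 8] bounds the other
   one. *)
assert (low : forall t, 0 < t < x -> - (t ^ 2 * moment 0 x ^ 2) <= G t).
{ intros t [t0 tx].
  pose proof (moment0_gt0 t); pose proof (moment0_le t x (conj t0 tx)).
  pose proof (gap_le t t0); pose proof (V_gt0 t t0); pose proof (dV_gt0 t t0).
  apply Rle_trans with (- (t ^ 2 * moment 0 t ^ 2)).
  - apply Ropp_le_contravar, Rmult_le_compat_l; [nra|].
    apply pow_incr; lra.
  - unfold G, curv.
    replace (t * moment 0 t ^ 2 * (2 * V t * dV t - gap t / t)) with
      (2 * t * (V t * dV t) * moment 0 t ^ 2
        - (t ^ 2 * moment 0 t ^ 2) * (gap t / t ^ 2)) by (field; lra).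
    assert (0 <= t ^ 2 * moment 0 t ^ 2) by nra.
    assert (0 < V t * dV t) by nra.
    assert (0 <= 2 * t * (V t * dV t) * moment 0 t ^ 2).
    { apply Rmult_le_pos; nra. }
    nra. }
enough (0 < G x).
{ unfold G in *; pose proof (moment0_gt0 x).
  apply Rmult_lt_reg_l with (x * moment 0 x ^ 2).
  - apply Rmult_lt_0_compat; [assumption | apply pow_lt; assumption].
  - lra. }
(* If [G x <= 0], then [G (x / 2) < 0], and [G] stays below that value further left. But [low] gives
   [G t >= G (x / 2)] once [t ^ 2 * m <= - G (x / 2)], which [t <= 1] and [t <= e] ensure. *)
destruct (Rlt_or_le 0 (G x)) as [|neg]; [assumption|exfalso].
pose proof (incr (x / 2) x ltac:(lra)) as Hx2.
set (m := moment 0 x ^ 2) in *.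
assert (m0 : 0 < m) by apply pow_lt, moment0_gt0.
set (e := - G (x / 2) / m).
assert (e0 : 0 < e) by (apply Rdiv_lt_0_compat; lra).
set (t := Rmin (x / 4) (Rmin 1 e)).
assert (t0 : 0 < t) by (apply Rmin_glb_lt; [lra | apply Rmin_glb_lt; lra]).
assert (tx : t <= x / 4) by apply Rmin_l.
assert (t1 : t <= 1) by (eapply Rle_trans; [apply Rmin_r | apply Rmin_l]).
assert (te : t <= e) by (eapply Rle_trans; [apply Rmin_r | apply Rmin_r]).
pose proof (low t ltac:(lra)); pose proof (incr t (x / 2) ltac:(lra)).
assert (t ^ 2 * m <= e * m) by (apply Rmult_le_compat_r; nra).
assert (e * m = - G (x / 2)) by (unfold e; field; lra).
lra.
Qed.

(** * The parametrized curve and its limit at 0 *)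

Definition curveK (x : R) : R := (x / V x + / dV x) / 2.
Definition curveL (x : R) : R := (x / V x - / dV x) / 2.
(* the derivatives of [x / V x] and [/ dV x] *)
Definition ds (x : R) : R := x * gap x / V x ^ 2.
Definition dd (x : R) : R := curv x / dV x ^ 2.
Definition slope (x : R) : R := (ds x - dd x) / (ds x + dd x).

Lemma ds_gt0 (x : R) : 0 < x -> 0 < ds x.
Proof.
intros x0; apply Rdiv_lt_0_compat.
- apply Rmult_lt_0_compat; [exact x0 | apply gap_gt0, x0].
- apply pow_lt, V_gt0, x0.
Qed.

Lemma dd_gt0 (x : R) : 0 < x -> 0 < dd x.
Proof.
intros x0; apply Rdiv_lt_0_compat.
- apply curv_gt0, x0.
- apply pow_lt, dV_gt0, x0.
Qed.

Lemma is_derive_curveK (x : R) : 0 < x -> is_derive curveK x ((ds x + dd x) / 2).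
Proof.
intros x0; pose proof (is_derive_V x x0) as D.
pose proof (is_derive_dV x x0) as D'.
pose proof (V_gt0 x x0); pose proof (dV_gt0 x x0).
unfold curveK; auto_derive.
- repeat split; try lra; eexists; [apply D|apply D'].
- rewrite (is_derive_unique (fun x : R => V x) _ _ D),
    (is_derive_unique (fun x : R => dV x) _ _ D').
  unfold ds, dd, gap; field; lra.
Qed.

Lemma is_derive_curveL (x : R) : 0 < x -> is_derive curveL x ((ds x - dd x) / 2).
Proof.
intros x0; pose proof (is_derive_V x x0) as D.
pose proof (is_derive_dV x x0) as D'.
pose proof (V_gt0 x x0); pose proof (dV_gt0 x x0).
unfold curveL; auto_derive.
- repeat split; try lra; eexists; [apply D|apply D'].
- rewrite (is_derive_unique (fun x : R => V x) _ _ D),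
    (is_derive_unique (fun x : R => dV x) _ _ D').
  unfold ds, dd, gap; field; lra.
Qed.

Lemma curveK_lt (a b : R) : 0 < a < b -> curveK a < curveK b.
Proof.
intros H; apply (increasing_of_derive _ (fun x => (ds x + dd x) / 2) a b H).
- intros c c0; apply is_derive_curveK, c0.
- intros c c0; pose proof (ds_gt0 c c0); pose proof (dd_gt0 c c0); lra.
Qed.

Lemma curveK_lt_inv (a b : R) : 0 < a -> 0 < b -> curveK a < curveK b -> a < b.
Proof.
intros a0 b0 H; destruct (Rtotal_order a b) as [|[E|E]]; [assumption|..].
- rewrite E in H; lra.
- pose proof (curveK_lt b a ltac:(lra)); lra.
Qed.

(** The parameter is the argument of [V] in the bifurcation equation, so [V x] is [r_star K L]. *)
Lemma bifurcation_point_param (K L : R) : bifurcation_point K L ->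
  let x := (K + L) * r_star K L in 0 < x /\ curveK x = K /\ curveL x = L.
Proof.
intros [L0 [KL E]] x; fold x in E.
assert (H1 : 0 < K ^ 2 - L ^ 2) by nra.
assert (H2 : 0 < 1 - 2 * K / (K ^ 2 - L ^ 2)).
{ replace (1 - 2 * K / (K ^ 2 - L ^ 2))
    with ((K ^ 2 - L ^ 2 - 2 * K) / (K ^ 2 - L ^ 2)) by (field; lra).
  apply Rdiv_lt_0_compat; nra. }
assert (r0 : 0 < r_star K L) by apply sqrt_lt_R0, H2.
assert (r2 : r_star K L ^ 2 = 1 - 2 * K / (K ^ 2 - L ^ 2)).
{ apply pow2_sqrt; lra. }
assert (x0 : 0 < x) by (apply Rmult_lt_0_compat; lra).
assert (s : x / V x = K + L) by (rewrite <- E; unfold x; field; lra).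
(* Here [2 * K / (K ^ 2 - L ^ 2) = / (K + L) + / (K - L)], and [/ (K + L) = V x / x] cancels in
   [dV x]. *)
assert (d : dV x = / (K - L)).
{ unfold dV; rewrite <- E, r2; unfold x; field; nra. }
split; [exact x0|].
unfold curveK, curveL; rewrite s, d, Rinv_inv; split; lra.
Qed.

Lemma Vdiv_inv (x : R) : 0 < x -> x / V x = / (V x / x).
Proof. intros x0; pose proof (V_gt0 x x0); field; lra. Qed.

(** [L < 0] amounts to [gap x > 0], and [K + L > 2] to [V x < x / 2]. *)
Lemma bifurcation_point_of_param (x : R) : 0 < x ->
  bifurcation_point (curveK x) (curveL x).
Proof.
intros x0.
pose proof (V_gt0 x x0) as v0; pose proof (dV_gt0 x x0) as p0.
pose proof (Vdiv_bounds x x0) as [b0 b1]; pose proof (gap_gt0 x x0) as g0.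
assert (sE : curveK x + curveL x = x / V x) by (unfold curveK, curveL; lra).
assert (r : r_star (curveK x) (curveL x) = V x).
{ unfold r_star; rewrite <- (sqrt_pow2 (V x)) by lra; f_equal.
  replace (curveK x ^ 2 - curveL x ^ 2) with (x / V x * / dV x)
    by (unfold curveK, curveL; field; lra).
  unfold curveK; replace (V x ^ 2) with (1 - V x / x - dV x)
    by (unfold dV; ring).
  field; lra. }
split; [|split].
- unfold curveL; rewrite (Vdiv_inv x x0).
  enough (/ (V x / x) < / dV x) by lra.
  apply Rinv_lt_contravar; [nra | unfold gap in g0; lra].
- rewrite sE, (Vdiv_inv x x0).
  rewrite <- (Rinv_inv 2) at 1; apply Rinv_lt_contravar; lra.
- rewrite r, sE; f_equal; field; lra.
Qed.

(** * Limits of the curve and of its slope at [0] *)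

Lemma filterlim_plus_R {T} (F : (T -> Prop) -> Prop) {FF : Filter F}
    (f g : T -> R) (a b : R) : filterlim f F (locally a) ->
  filterlim g F (locally b) -> filterlim (fun t => f t + g t) F (locally (a + b)).
Proof.
intros Hf Hg; eapply filterlim_comp_2; [exact Hf | exact Hg |].
apply (filterlim_plus (V := R_NormedModule)).
Qed.

Lemma filterlim_mult_R {T} (F : (T -> Prop) -> Prop) {FF : Filter F}
    (f g : T -> R) (a b : R) : filterlim f F (locally a) ->
  filterlim g F (locally b) -> filterlim (fun t => f t * g t) F (locally (a * b)).
Proof.
intros Hf Hg; eapply filterlim_comp_2; [exact Hf | exact Hg |].
apply (filterlim_mult (K := R_AbsRing)).
Qed.

Lemma filterlim_inv_R {T} (F : (T -> Prop) -> Prop) (f : T -> R) (a : R) :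
  a <> 0 -> filterlim f F (locally a) ->
  filterlim (fun t => / f t) F (locally (/ a)).
Proof.
intros a0 Hf; eapply filterlim_comp; [exact Hf|].
apply (ex_derive_continuous Rinv); auto_derive; exact a0.
Qed.

Lemma filterlim_at_right_0 (f : R -> R) (l : R) :
  (forall x, 0 < x < 1 -> Rabs (f x - l) <= x) ->
  filterlim f (at_right 0) (locally l).
Proof.
intros H; apply filterlim_locally; intros [e e0].
assert (m0 : 0 < Rmin e 1) by (apply Rmin_glb_lt; lra).
exists (mkposreal _ m0); intros x B x0.
unfold ball in *; simpl in *; unfold AbsRing_ball, abs, minus, plus, opp in *.
simpl in *; rewrite Ropp_0, Rplus_0_r, Rabs_pos_eq in B by lra.
pose proof (Rmin_l e 1); pose proof (Rmin_r e 1).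
eapply Rle_lt_trans; [apply H; lra | lra].
Qed.

Lemma V_sqr_le (x : R) : 0 < x -> V x ^ 2 <= x ^ 2 / 4.
Proof. intros x0; pose proof (V_gt0 x x0); pose proof (V_lt_half x x0); nra. Qed.

(** [gap x > 0] reads [2 * V x / x > 1 - V x ^ 2]. *)
Lemma Vdiv_ge (x : R) : 0 < x -> / 2 - x ^ 2 / 8 <= V x / x.
Proof.
intros x0; pose proof (gap_gt0 x x0); pose proof (V_sqr_le x x0).
unfold gap, dV in *; lra.
Qed.

Lemma dV_ge (x : R) : 0 < x -> / 2 - x ^ 2 / 4 <= dV x.
Proof.
intros x0; pose proof (Vdiv_bounds x x0); pose proof (V_sqr_le x x0).
unfold dV; lra.
Qed.

Lemma Vdiv_lim_0 : filterlim (fun x => V x / x) (at_right 0) (locally (/ 2)).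
Proof.
apply filterlim_at_right_0; intros x [x0 x1].
pose proof (Vdiv_bounds x x0); pose proof (Vdiv_ge x x0).
apply Rabs_le; split; nra.
Qed.

Lemma dV_lim_0 : filterlim dV (at_right 0) (locally (/ 2)).
Proof.
apply filterlim_at_right_0; intros x [x0 x1].
pose proof (dV_lt_half x x0); pose proof (dV_ge x x0).
apply Rabs_le; split; nra.
Qed.

Lemma gap_lim_0 : filterlim (fun x => gap x / x ^ 2) (at_right 0) (locally (/ 8)).
Proof.
apply filterlim_at_right_0; intros x [x0 x1].
pose proof (gap_le x x0); destruct (gap_mvt x x0) as [c [[c0 cx] E]].
(* Since [c < x < 1], the quadratic errors at the intermediate point [c] are absorbed by the linear
   bound [x]. *)
assert (c ^ 2 <= x ^ 2) by nra.
assert (x ^ 2 <= x) by nra.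
pose proof (Vdiv_ge c c0); pose proof (dV_ge c c0).
pose proof (Rmult_le_compat (/ 2 - x ^ 2 / 8) (V c / c) (/ 2 - x ^ 2 / 4) (dV c)
  ltac:(nra) ltac:(nra) ltac:(lra) ltac:(lra)).
apply Rabs_le; split; nra.
Qed.

Lemma curveK_lim_0 : filterlim curveK (at_right 0) (locally 2).
Proof.
apply filterlim_ext_loc with (fun x => (/ (V x / x) + / dV x) * / 2).
- exists (mkposreal _ Rlt_0_1); intros x _ x0.
  unfold curveK; now rewrite (Vdiv_inv x x0).
- replace (locally 2) with (locally ((/ / 2 + / / 2) * / 2))
    by (f_equal; field).
  refine (filterlim_mult_R _ _ _ _ _ _ _); [|apply filterlim_const].
  refine (filterlim_plus_R _ _ _ _ _ _ _); apply filterlim_inv_R; try lra.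
  + apply Vdiv_lim_0.
  + apply dV_lim_0.
Qed.

Lemma slope_lim_0 : filterlim slope (at_right 0) (locally (-1 / 2)).
Proof.
(* [a] and [b] are [ds] and [dd] divided by their common vanishing factor [x]; they tend to [1 / 2]
   and [3 / 2]. *)
set (a x := gap x / x ^ 2 * / (V x / x * (V x / x))).
set (b x := (2 * (V x / x * dV x) + -1 * (gap x / x ^ 2)) * / (dV x * dV x)).
assert (Ha : filterlim a (at_right 0) (locally (/ 8 * / (/ 2 * / 2)))).
{ refine (filterlim_mult_R _ _ _ _ _ _ _); [apply gap_lim_0|].
  apply filterlim_inv_R; [lra|].
  refine (filterlim_mult_R _ _ _ _ _ _ _); apply Vdiv_lim_0. }
assert (Hb : filterlim b (at_right 0) (locally
  ((2 * (/ 2 * / 2) + -1 * / 8) * / (/ 2 * / 2)))).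
{ refine (filterlim_mult_R _ _ _ _ _ _ _).
  - refine (filterlim_plus_R _ _ _ _ _ _ _); refine (filterlim_mult_R _ _ _ _ _ _ _);
      try apply filterlim_const; try apply gap_lim_0.
    refine (filterlim_mult_R _ _ _ _ _ _ _); [apply Vdiv_lim_0 | apply dV_lim_0].
  - apply filterlim_inv_R; [lra|].
    refine (filterlim_mult_R _ _ _ _ _ _ _); apply dV_lim_0. }
apply filterlim_ext_loc with (fun x => (a x + -1 * b x) * / (a x + b x)).
- exists (mkposreal _ Rlt_0_1); intros x _ x0.
  assert (Ea : ds x = x * a x).
  { unfold ds, a; pose proof (V_gt0 x x0); field; lra. }
  assert (Eb : dd x = x * b x).
  { unfold dd, curv, b; pose proof (dV_gt0 x x0); field; lra. }
  pose proof (ds_gt0 x x0); pose proof (dd_gt0 x x0).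
  assert (0 < x * (a x + b x)) by lra.
  unfold slope; rewrite Ea, Eb; field; split; nra.
- replace (-1 / 2) with ((/ 8 * / (/ 2 * / 2) + -1 *
      ((2 * (/ 2 * / 2) + -1 * / 8) * / (/ 2 * / 2))) *
    / (/ 8 * / (/ 2 * / 2) + (2 * (/ 2 * / 2) + -1 * / 8) * / (/ 2 * / 2)))
    by field.
  refine (filterlim_mult_R _ _ _ _ _ _ _); [|apply filterlim_inv_R; [lra|]];
    refine (filterlim_plus_R _ _ _ _ _ _ _); try assumption.
  refine (filterlim_mult_R _ _ _ _ _ _ _); [apply filterlim_const | assumption].
Qed.

(** * The limit at infinity *)

Lemma V_lt1 (x : R) : 0 < x -> V x < 1.
Proof.
intros x0; pose proof (Vdiv_bounds x x0); pose proof (dV_gt0 x x0).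
unfold dV in *; nra.
Qed.

Lemma V_lt (a b : R) : 0 < a < b -> V a < V b.
Proof.
intros H; apply (increasing_of_derive V dV a b H).
- exact is_derive_V.
- exact dV_gt0.
Qed.

Lemma dV_gt (a b : R) : 0 < a < b -> dV b < dV a.
Proof.
intros H; enough (- dV a < - dV b) by lra.
apply (increasing_of_derive (fun x => - dV x) curv a b H).
- intros c c0; pose proof (is_derive_dV c c0) as D.
  rewrite <- (Ropp_involutive (curv c)).
  apply (is_derive_opp dV _ _ D).
- exact curv_gt0.
Qed.

(** [gap x > 0] and [V x < 1] give [V x ^ 2 > 1 - 2 / x], and [V x >= V x ^ 2]. *)
Lemma V_ge (x : R) : 0 < x -> 1 - 2 / x <= V x.
Proof.
intros x0; pose proof (V_gt0 x x0); pose proof (V_lt1 x x0).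
pose proof (gap_gt0 x x0) as g0.
assert (V x / x <= 1 / x) by (apply Rmult_le_compat_r;
  [left; apply Rinv_0_lt_compat, x0 | lra]).
unfold gap, dV, Rdiv in *; nra.
Qed.

(* By concavity, [dV x * (x / 2) <= V x - V (x / 2) <= 1 - V (x / 2)]. *)
Lemma dV_le (x : R) : 0 < x -> dV x <= 8 / x ^ 2.
Proof.
intros x0; destruct (is_derive_mvt V dV (x / 2) x ltac:(lra)) as [c [Hc E]].
{ intros c Hc; apply is_derive_V; lra. }
pose proof (dV_gt c x ltac:(lra)); pose proof (V_ge (x / 2) ltac:(lra)) as H1.
pose proof (V_lt1 x x0).
replace (2 / (x / 2)) with (4 / x) in H1 by (field; lra).
assert (H2 : dV x * (x / 2) <= 4 / x) by nra.
apply Rmult_le_reg_r with (x / 2); [lra|].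
replace (8 / x ^ 2 * (x / 2)) with (4 / x) by (field; lra); exact H2.
Qed.

(** [V x / x] exceeds [V 1 / x], and beyond [16 / V 1] the bound [8 / x ^ 2] on [dV x] is at most
    half of that. *)
Lemma gap_ge (x : R) : 16 / V 1 <= x -> V 1 / 2 / x <= gap x.
Proof.
intros Hx; pose proof (V_gt0 1 Rlt_0_1) as v0; pose proof (V_lt1 1 Rlt_0_1) as v1.
assert (Hx' : 16 <= V 1 * x).
{ apply (Rmult_le_compat_l (V 1)) in Hx; [|lra].
  replace (V 1 * (16 / V 1)) with 16 in Hx by (field; lra); exact Hx. }
assert (x1 : 1 < x) by nra.
pose proof (dV_le x ltac:(lra)) as H1; pose proof (V_lt 1 x ltac:(lra)) as H2.
unfold gap; apply Rle_trans with (V 1 / x - 8 / x ^ 2).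
- apply Rmult_le_reg_r with (x ^ 2); [nra|].
  replace (V 1 / 2 / x * x ^ 2) with (V 1 * x / 2) by (field; lra).
  replace ((V 1 / x - 8 / x ^ 2) * x ^ 2) with (V 1 * x - 8) by (field; lra).
  lra.
- apply Rplus_le_compat; [apply Rmult_le_compat_r; [|lra] | lra].
  left; apply Rinv_0_lt_compat; lra.
Qed.

(* Gronwall: since [1 / x + 2 * V x <= 3], one has
   [curv' + 3 * curv >= 2 * gap x / x ^ 2 >= V 1 / x ^ 3]. *)
Lemma curv_ge :
  exists c, 0 < c /\ forall x, 16 / V 1 <= x -> c / x ^ 3 <= curv x.
Proof.
pose proof (V_gt0 1 Rlt_0_1) as v0; pose proof (V_lt1 1 Rlt_0_1) as v1.
set (y := 16 / V 1).
assert (y1 : 1 < y).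
{ apply Rmult_lt_reg_r with (V 1); [exact v0|].
  unfold y, Rdiv; rewrite Rmult_assoc, Rinv_l; lra. }
pose proof (curv_gt0 y ltac:(lra)) as q0.
assert (y3 : 0 < y ^ 3) by (apply pow_lt; lra).
(* The first bound on [c] serves the differential inequality for [curv t - c / t ^ 3], the second
   its sign at the starting point [y]. *)
set (c := Rmin (V 1 / 3) (curv y * y ^ 3)).
assert (c0 : 0 < c) by (apply Rmin_glb_lt; nra).
assert (c1 : c <= V 1 / 3) by apply Rmin_l.
assert (c2 : c <= curv y * y ^ 3) by apply Rmin_r.
assert (cy : c / y ^ 3 <= curv y).
{ apply Rmult_le_reg_r with (y ^ 3); [exact y3|].
  unfold Rdiv; rewrite Rmult_assoc, Rinv_l; lra. }
exists c; split; [exact c0|]; intros x [yx|<-]; [|exact cy].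
(* The factor [exp (3 * t)] turns the Gronwall inequality into monotonicity. *)
destruct (is_derive_mvt (fun t => exp (3 * t) * (curv t - c / t ^ 3))
  (fun t => exp (3 * t) * (3 * (curv t - c / t ^ 3)
    + (2 * (gap t / t ^ 2 + dV t ^ 2) - (1 / t + 2 * V t) * curv t)
    + 3 * c / t ^ 4)) y x yx) as [t [Ht E]].
{ intros t Ht; pose proof (is_derive_curv t ltac:(lra)) as D.
  auto_derive.
  - repeat split; [eexists; apply D|].
    assert (0 < t) by lra; apply Rgt_not_eq; nra.
  - rewrite (is_derive_unique (fun x : R => curv x) _ _ D).
    field; lra. }
enough (P : 0 <= exp (3 * x) * (curv x - c / x ^ 3)).
{ pose proof (exp_pos (3 * x)); nra. }
assert (P0 : 0 <= exp (3 * y) * (curv y - c / y ^ 3)).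
{ apply Rmult_le_pos; [left; apply exp_pos | lra]. }
match type of E with _ = ?d * _ => enough (Hd : 0 <= d) by nra end.
apply Rmult_le_pos; [left; apply exp_pos|].
pose proof (curv_gt0 t ltac:(lra)) as qt; pose proof (V_lt1 t ltac:(lra)).
pose proof (gap_ge t ltac:(fold y; lra)) as gt.
assert (i1 : 1 / t < 1).
{ apply Rmult_lt_reg_r with t; [lra|].
  unfold Rdiv; rewrite Rmult_assoc, Rinv_l; lra. }
assert (i2 : 0 < / t ^ 2) by (apply Rinv_0_lt_compat, pow_lt; lra).
assert (i3 : 0 < / t ^ 3) by (apply Rinv_0_lt_compat, pow_lt; lra).
assert (i4 : 0 < 3 * c / t ^ 4).
{ apply Rdiv_lt_0_compat; [lra | apply pow_lt; lra]. }
assert (H1 : (1 / t + 2 * V t) * curv t <= 3 * curv t).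
{ apply Rmult_le_compat_r; lra. }
assert (H2 : V 1 / 2 / t * / t ^ 2 <= gap t / t ^ 2).
{ apply Rmult_le_compat_r; lra. }
replace (V 1 / 2 / t * / t ^ 2) with (V 1 / 2 * / t ^ 3) in H2 by (field; lra).
assert (H3 : 3 * (c / t ^ 3) <= V 1 * / t ^ 3) by (unfold Rdiv; nra).
pose proof (pow2_ge_0 (dV t)).
lra.
Qed.

Lemma slope_lim_p : filterlim slope (Rbar_locally p_infty) (locally (-1)).
Proof.
destruct curv_ge as [c [c0 Hc]].
pose proof (V_gt0 1 Rlt_0_1) as v0; pose proof (V_lt1 1 Rlt_0_1) as v1.
set (y := 16 / V 1) in *.
assert (y1 : 1 < y).
{ apply Rmult_lt_reg_r with (V 1); [exact v0|].
  unfold y, Rdiv; rewrite Rmult_assoc, Rinv_l; lra. }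
(* [slope x + 1 = 2 * ds x / (ds x + dd x)], where [ds] is at most [/ V 1] and [dd x] is at least
   [c * x / 64], from [curv x >= c / x ^ 3] and [dV x <= 8 / x ^ 2]. *)
assert (H : forall x, y <= x -> Rabs (slope x - -1) <= 128 / (c * V 1) / x).
{ intros x yx.
  assert (x0 : 0 < x) by lra.
  pose proof (ds_gt0 x x0) as s0; pose proof (dd_gt0 x x0) as d0.
  pose proof (V_gt0 x x0) as vx; pose proof (dV_gt0 x x0) as px.
  assert (Hs : ds x <= / V 1).
  { apply Rle_trans with (/ V x).
    - apply Rmult_le_reg_r with (V x ^ 2); [apply pow_lt, vx|].
      unfold ds, gap.
      replace (x * (V x / x - dV x) / V x ^ 2 * V x ^ 2)
        with (V x - x * dV x) by (field; lra).
      replace (/ V x * V x ^ 2) with (V x) by (field; lra).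
      nra.
    - apply Rinv_le_contravar; [exact v0 | left; apply V_lt; lra]. }
  assert (Hd : c * x / 64 <= dd x).
  { apply Rmult_le_reg_r with (dV x ^ 2); [apply pow_lt, px|].
    unfold dd, Rdiv at 2; rewrite Rmult_assoc, Rinv_l, Rmult_1_r.
    2: { apply Rgt_not_eq, pow_lt, px. }
    apply Rle_trans with (c / x ^ 3); [|apply Hc, yx].
    replace (c / x ^ 3) with (c * x / 64 * (8 / x ^ 2) ^ 2) by (field; lra).
    apply Rmult_le_compat_l; [nra|].
    apply pow_incr; split; [lra | apply dV_le, x0]. }
  assert (cx : 0 < c * x / 64) by nra.
  assert (Es : slope x - -1 = 2 * ds x * / (ds x + dd x)).
  { unfold slope; field; lra. }
  rewrite Es, Rabs_pos_eq.
  2: { apply Rmult_le_pos; [lra | left; apply Rinv_0_lt_compat; lra]. }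
  replace (128 / (c * V 1) / x) with (2 * / V 1 * / (c * x / 64))
    by (field; lra).
  apply Rmult_le_compat; [lra | left; apply Rinv_0_lt_compat; lra | lra |].
  apply Rinv_le_contravar; lra. }
set (M := 128 / (c * V 1)) in *.
assert (M0 : 0 < M) by (apply Rdiv_lt_0_compat; nra).
apply filterlim_locally; intros [e e0].
exists (Rmax y (M / e)); intros x Hx.
pose proof (Rmax_l y (M / e)); pose proof (Rmax_r y (M / e)).
unfold ball; simpl; unfold AbsRing_ball, abs, minus, plus, opp; simpl.
eapply Rle_lt_trans; [apply H; lra|].
apply Rmult_lt_reg_r with x; [lra|].
unfold Rdiv at 1; rewrite Rmult_assoc, Rinv_l, Rmult_1_r by lra.
assert (Hx' : M / e < x) by lra.
apply (Rmult_lt_compat_l e) in Hx'; [|exact e0].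
replace (e * (M / e)) with M in Hx' by (field; lra); exact Hx'.
Qed.

(** * The bifurcation line as a function of K *)

Lemma curveK_ge (x : R) : 0 < x -> x / 2 <= curveK x.
Proof.
intros x0; pose proof (V_gt0 x x0); pose proof (V_lt1 x x0).
pose proof (Rinv_0_lt_compat _ (dV_gt0 x x0)).
assert (x <= x / V x).
{ apply Rmult_le_reg_r with (V x); [assumption|].
  unfold Rdiv; rewrite Rmult_assoc, Rinv_l; nra. }
unfold curveK; lra.
Qed.

Lemma curveK_surj (K : R) : 2 < K -> exists x, 0 < x /\ curveK x = K.
Proof.
intros K2.
assert (Ha : exists a, 0 < a /\ curveK a < K).
{ destruct (proj1 (filterlim_locally curveK 2) curveK_lim_0
    (mkposreal (K - 2) ltac:(lra))) as [[e e0] He].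
  exists (e / 2); split; [lra|].
  specialize (He (e / 2)); simpl in He.
  unfold ball in He; simpl in He.
  unfold AbsRing_ball, abs, minus, plus, opp in He; simpl in He.
  rewrite Ropp_0, Rplus_0_r, Rabs_pos_eq in He by lra.
  assert (H1 : e / 2 < e) by lra; assert (H2 : 0 < e / 2) by lra.
  specialize (He H1 H2).
  apply Rabs_lt_between in He; lra. }
destruct Ha as [a [a0 Ha]].
(* [b >= 2 * K + 1] gives [curveK b >= b / 2 > K]. *)
set (b := Rmax (a + 1) (2 * K + 1)).
assert (ab : a < b) by (pose proof (Rmax_l (a + 1) (2 * K + 1)); unfold b; lra).
assert (Hb : K < curveK b).
{ pose proof (curveK_ge b ltac:(lra)).
  pose proof (Rmax_r (a + 1) (2 * K + 1)); unfold b in *; lra. }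
destruct (IVT_interv (fun x => curveK x - K) a b) as [x [Hx E]]; try lra.
- intros x Hx; apply continuity_pt_filterlim.
  apply (ex_derive_continuous (fun x => curveK x - K)).
  auto_derive; repeat split; eexists; apply is_derive_curveK; lra.
- exists x; split; lra.
Qed.

(** * Inverting [curveK] and differentiating the bifurcation line *)

Section Curve.

Variable Lstar : R -> R.
Hypothesis HL : forall K, K > 2 -> bifurcation_point K (Lstar K).

(** The curve parameter of the point over [K]: for [K > 2], the inverse of [curveK]. *)
Let X (K : R) : R := (K + Lstar K) * r_star K (Lstar K).

Lemma X_gt0 (K : R) : K > 2 -> 0 < X K.
Proof. intros K2; apply (bifurcation_point_param _ _ (HL K K2)). Qed.

Lemma curveK_X (K : R) : K > 2 -> curveK (X K) = K.
Proof. intros K2; apply (bifurcation_point_param _ _ (HL K K2)). Qed.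

Lemma curveL_X (K : R) : K > 2 -> curveL (X K) = Lstar K.
Proof. intros K2; apply (bifurcation_point_param _ _ (HL K K2)). Qed.

Lemma X_lt (K x : R) : K > 2 -> 0 < x -> K < curveK x -> X K < x.
Proof.
intros K2 x0 H; apply curveK_lt_inv; [apply X_gt0, K2 | exact x0|].
now rewrite curveK_X.
Qed.

Lemma X_gt (K x : R) : K > 2 -> 0 < x -> curveK x < K -> x < X K.
Proof.
intros K2 x0 H; apply curveK_lt_inv; [exact x0 | apply X_gt0, K2 |].
now rewrite curveK_X.
Qed.

Lemma curveK_gt2 (x : R) : 0 < x -> 2 < curveK x.
Proof.
intros x0; destruct (bifurcation_point_of_param x x0) as [H1 [H2 _]]; lra.
Qed.

Lemma continuity_X (K : R) : K > 2 -> continuity_pt X K.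
Proof.
intros K2 e e0; pose proof (X_gt0 K K2) as x0.
set (x := X K) in *.
(* [h <= x / 2] keeps [x - h] positive, where [curveK] is monotone. *)
set (h := Rmin e (x / 2)).
assert (h0 : 0 < h) by (apply Rmin_glb_lt; lra).
assert (hx : h <= x / 2) by apply Rmin_r.
assert (he : h <= e) by apply Rmin_l.
pose proof (curveK_lt (x - h) x ltac:(lra)) as H1.
pose proof (curveK_lt x (x + h) ltac:(lra)) as H2.
assert (E : curveK x = K) by apply curveK_X, K2.
(* This keeps every [K'] within [d] of [K] above [2], where [X] inverts [curveK]. *)
pose proof (curveK_gt2 (x - h) ltac:(lra)) as H3.
set (d := Rmin (K - curveK (x - h)) (curveK (x + h) - K)).
exists d; split; [apply Rmin_glb_lt; lra|].
intros K' [_ B]; simpl in *; unfold R_dist in *.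
assert (d1 : d <= K - curveK (x - h)) by apply Rmin_l.
assert (d2 : d <= curveK (x + h) - K) by apply Rmin_r.
apply Rabs_lt_between in B.
pose proof (X_gt K' (x - h) ltac:(lra) ltac:(lra) ltac:(lra)).
pose proof (X_lt K' (x + h) ltac:(lra) ltac:(lra) ltac:(lra)).
apply Rabs_lt_between; fold x; lra.
Qed.

(** The derivative of an inverse function, on an interval around [K] that stays to the right of
    [2]. *)
Lemma is_derive_X (K : R) : K > 2 ->
  is_derive X K (/ ((ds (X K) + dd (X K)) / 2)).
Proof.
intros K2.
set (lb := (K + 2) / 2); set (ub := K + 1).
assert (Hlb : 2 < lb < K) by (unfold lb; lra).
assert (Hub : K < ub) by (unfold ub; lra).
assert (Xlb : X lb < X K).
{ apply X_lt; [lra | apply X_gt0, K2 | rewrite curveK_X; lra]. }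
assert (Xub : X K < X ub).
{ apply X_gt; [lra | apply X_gt0, K2 | rewrite curveK_X; lra]. }
pose proof (X_gt0 lb ltac:(lra)) as Xlb0.
assert (Prf : forall a, X lb <= a <= X ub -> derivable_pt curveK a).
{ intros a Ha; eexists; apply is_derive_Reals, is_derive_curveK; lra. }
assert (Prg : X lb <= X K <= X ub) by lra.
assert (D : derive_pt curveK (X K) (Prf (X K) Prg) = (ds (X K) + dd (X K)) / 2).
{ apply derive_pt_eq, is_derive_Reals, is_derive_curveK, X_gt0, K2. }
pose proof (ds_gt0 _ (X_gt0 K K2)); pose proof (dd_gt0 _ (X_gt0 K K2)).
apply is_derive_Reals.
rewrite <- D, <- Rdiv_1_l.
apply (derivable_pt_lim_recip_interv curveK X lb ub).
- apply continuity_X, K2.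
- lra.
- lra.
- intros z Hz; apply (curveK_X z); lra.
- rewrite D; lra.
Qed.

(** Chain rule for [curveL] after [X], which agrees with [Lstar] on the ball of radius [K - 2]
    around [K]. *)
Lemma is_derive_Lstar (K : R) : K > 2 -> is_derive Lstar K (slope (X K)).
Proof.
intros K2; pose proof (X_gt0 K K2) as x0.
pose proof (ds_gt0 _ x0); pose proof (dd_gt0 _ x0).
apply is_derive_ext_loc with (fun K => curveL (X K)).
{ exists (mkposreal (K - 2) ltac:(lra)); intros y B.
  apply curveL_X; unfold ball in B; simpl in B.
  unfold AbsRing_ball, abs, minus, plus, opp in B; simpl in B.
  apply Rabs_lt_between in B; lra. }
replace (slope (X K)) with
  (/ ((ds (X K) + dd (X K)) / 2) * ((ds (X K) - dd (X K)) / 2))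
  by (unfold slope; field; lra).
apply (is_derive_comp curveL X); [apply is_derive_curveL, x0 | apply is_derive_X, K2].
Qed.

Lemma filterlim_X_p : filterlim X (Rbar_locally p_infty) (Rbar_locally p_infty).
Proof.
intros P [M HM]; set (m := Rmax M 1).
assert (m1 : 1 <= m) by apply Rmax_r.
assert (mM : M <= m) by apply Rmax_l.
pose proof (curveK_gt2 m ltac:(lra)).
exists (curveK m); intros K HK; apply HM.
pose proof (X_gt K m ltac:(lra) ltac:(lra) HK); lra.
Qed.

(** Monotonicity suffices: [2 < K < curveK e] forces [0 < X K < e]. *)
Lemma filterlim_X_2 : filterlim X (at_right 2) (at_right 0).
Proof.
intros P [[e e0] HP]; pose proof (curveK_gt2 e e0) as H2.
exists (mkposreal (curveK e - 2) ltac:(lra)); intros K B K2.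
unfold ball in B; simpl in B.
unfold AbsRing_ball, abs, minus, plus, opp in B; simpl in B.
apply Rabs_lt_between in B.
pose proof (X_lt K e K2 e0 ltac:(lra)); pose proof (X_gt0 K K2).
apply HP; [|assumption].
unfold ball; simpl; unfold AbsRing_ball, abs, minus, plus, opp; simpl.
rewrite Rabs_pos_eq; lra.
Qed.

Lemma Derive_lim_p : is_lim (Derive Lstar) p_infty (-1).
Proof.
apply filterlim_ext_loc with (fun K => slope (X K)).
- exists 2; intros K K2; symmetry; apply is_derive_unique, is_derive_Lstar, K2.
- eapply filterlim_comp; [exact filterlim_X_p | exact slope_lim_p].
Qed.

Lemma Derive_lim_2 : filterlim (Derive Lstar) (at_right 2) (locally (-1 / 2)).
Proof.
apply filterlim_ext_loc with (fun K => slope (X K)).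
- exists (mkposreal _ Rlt_0_1); intros K _ K2.
  symmetry; apply is_derive_unique, is_derive_Lstar, K2.
- eapply filterlim_comp; [exact filterlim_X_2 | exact slope_lim_0].
Qed.

End Curve.

(** Unique existence makes the implicit definition meaningful. The limits are stated for every
    function that solves it on [K > 2], with arbitrary values elsewhere; differentiability ensures
    that [Derive] is a true derivative there. *)
Theorem theorem4p5 :
  (forall K : R, K > 2 -> exists! L : R, bifurcation_point K L) /\
  (forall Lstar : R -> R,
     (forall K : R, K > 2 -> bifurcation_point K (Lstar K)) ->
     (forall K : R, K > 2 -> ex_derive Lstar K) /\
     is_lim (Derive Lstar) p_infty (-1) /\
     filterlim (Derive Lstar) (at_right 2) (locally (-1 / 2))).
Proof.
split.
- intros K K2; destruct (curveK_surj K K2) as [x [x0 E]].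
  exists (curveL x); split.
  + rewrite <- E; apply bifurcation_point_of_param, x0.
  + intros L HL; destruct (bifurcation_point_param K L HL) as [y0 [EK EL]].
    set (y := (K + L) * r_star K L) in *.
    rewrite <- EL; f_equal.
    (* Two points over the same [K] have equal parameters, [curveK] being strictly increasing. *)
    destruct (Rtotal_order x y) as [H|[H|H]]; [|exact H|].
    * pose proof (curveK_lt x y ltac:(lra)); lra.
    * pose proof (curveK_lt y x ltac:(lra)); lra.
- intros Lstar HL; split; [|split].
  + intros K K2; eexists; apply (is_derive_Lstar Lstar HL K K2).
  + apply Derive_lim_p, HL.
  + apply Derive_lim_2, HL.
Qed.
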